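(* Let $m\ge2$ and let $\Phi\big((w_{ij})_{1\le i<j\le m}\big)$ be a continuous function of the $\binom m2$ variables $w_{ij}\in[0,1]$. The following are equivalent: (i) There exist a graphon $W$ and a function $h$ on $[0,1]$, $h$ not a.e. $0$, such that $\Phi_W(x_1,\dots,x_m)=\sum_{i=1}^m h(x_i)$ for a.e. $(x_1,\dots,x_m)\in[0,1]^m$, but $W$ is not a.e. constant. (ii) There exist a 2-type graphon $W$ and a function $h$ on $[0,1]$, $h$ not a.e. $0$, such that $\Phi_W(x_1,\dots,x_m)=\sum_{i=1}^m h(x_i)$ for all $(x_1,\dots,x_m)$, but $W$ is not constant. (iii) There exist $u,v,s\in[0,1]$, not all equal, and $a,b\in\mathbb R$, not both $0$, such that for every subset $A\subseteq\{1,\dots,m\}$, setting $w_{ij}=u$ if $i,j\in A$, $w_{ij}=v$ if $i,j\notin A$, and $w_{ij}=s$ if exactly one of $i,j$ is in $A$, we have $\Phi((w_{ij})_{i<j})=a+b|A|$.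
   Context: A graphon is a symmetric measurable $W:[0,1]^2\to[0,1]$. $\Phi_W(x_1,\dots,x_m):=\Phi\big((W(x_i,x_j))_{i<j}\big)$. A 2-type graphon is a graphon that is constant on each set $S_i\times S_j$, $i,j\in\{1,2\}$, for some partition $[0,1]=S_1\cup S_2$ into two disjoint measurable sets. *)

(* Defs.v *)
From HB Require Import structures.
From mathcomp Require Import all_boot all_order all_algebra.
From mathcomp Require Import all_classical all_reals all_analysis.

Set Implicit Arguments.
Unset Strict Implicit.
Unset Printing Implicit Defensive.

Import Order.TTheory GRing.Theory Num.Theory.
Import numFieldNormedType.Exports.

Local Open Scope classical_set_scope.
Local Open Scope ring_scope.

Lemma prod_sigma_finite d1 d2 (T1 : measurableType d1) (T2 : measurableType d2)
    (R : realType) (m1 : {sigma_finite_measure set T1 -> \bar R})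
    (m2 : {sigma_finite_measure set T2 -> \bar R}) :
  sigma_finite setT (m1 \x m2)%E.
Proof.
have /sigma_finiteP[F [TF ndF Foo]] := sigma_finiteT m1.
have /sigma_finiteP[G [TG ndG Goo]] := sigma_finiteT m2.
exists (fun n => F n `*` G n).
  rewrite -setXTT TF TG predeqE => -[x y]; split.
    move=> [/= [n _ Fnx] [k _ Gky]]; exists (maxn n k) => //; split.
    - by move: x Fnx; exact/subsetPset/ndF/leq_maxl.
    - by move: y Gky; exact/subsetPset/ndG/leq_maxr.
  by move=> [n _ []/= ? ?]; split; exists n.
move=> k; have [? ?] := Foo k; have [? ?] := Goo k.
split; first exact: measurableX.
by rewrite product_measure1E// lte_mul_pinfty// ge0_fin_numE.
Qed.

Section lebesgue_tuple.
Context {R : realType}.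
Local Notation T := (measurableTypeR R).

Definition tuple_cons n (p : T * n.-tuple T) : n.+1.-tuple T :=
  [tuple of p.1 :: p.2].

(* n-dimensional Lebesgue measure on the Borel sets of R^n, as the n-fold
   product of the one-dimensional one. *)
Fixpoint lebesgue_tuple (n : nat) : set (n.-tuple T) -> \bar R :=
  match n with
  | 0 => dirac [tuple]
  | n'.+1 =>
      pushforward (lebesgue_measure \x @lebesgue_tuple n')%E (@tuple_cons n')
  end.

Lemma measurable_tuple_cons n : measurable_fun setT (@tuple_cons n).
Proof. exact: measurable_cons. Qed.

Let tuple_uncons n (t : n.+1.-tuple T) : T * n.-tuple T :=
  (thead t, [tuple of behead t]).

Let tuple_consK n : cancel (@tuple_cons n) (@tuple_uncons n).
Proof. by case=> x t; congr pair; exact: val_inj. Qed.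

Let measurable_tuple_uncons n : measurable_fun setT (@tuple_uncons n).
Proof.
apply: measurable_fun_pair; first exact: measurable_tnth.
exact: measurable_behead.
Qed.

Definition tuple_step n (m : {sigma_finite_measure set (n.-tuple T) -> \bar R}) :=
  pushforward (lebesgue_measure \x m)%E (@tuple_cons n).

Section step.
Context n (m : {sigma_finite_measure set (n.-tuple T) -> \bar R}).

Let step0 : tuple_step m set0 = 0%E.
Proof. by rewrite /tuple_step /pushforward preimage_set0 measure0. Qed.

Let step_ge0 A : (0 <= tuple_step m A)%E.
Proof. by rewrite /tuple_step /pushforward; apply: measure_ge0. Qed.

Let step_sigma_additive : semi_sigma_additive (tuple_step m).
Proof.
move=> F mF tF mUF; rewrite /tuple_step /pushforward preimage_bigcup.
have mc A : measurable A -> measurable (@tuple_cons n @^-1` A).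
  by move=> mA; rewrite -[X in measurable X]setTI; exact: measurable_tuple_cons.
apply: measure_semi_sigma_additive.
- by move=> k; exact: mc.
- apply/trivIsetP => /= i j _ _ ij; rewrite -preimage_setI.
  by move/trivIsetP : tF => /(_ _ _ _ _ ij) ->//; rewrite preimage_set0.
- by rewrite -preimage_bigcup; exact: mc.
Qed.

HB.instance Definition _ := isMeasure.Build _ _ _
  (tuple_step m) step0 step_ge0 step_sigma_additive.

Let step_sigma_finite : sigma_finite setT (tuple_step m).
Proof.
have [F TF Foo] := prod_sigma_finite lebesgue_measure m.
exists (fun k => @tuple_uncons n @^-1` F k) => [|k].
  by rewrite -preimage_bigcup -TF preimage_setT.
have [mF Fk] := Foo k; split.
  by rewrite -[X in measurable X]setTI; exact: measurable_tuple_uncons.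
rewrite /tuple_step /pushforward -comp_preimage (_ : _ \o _ = id) ?preimage_id//.
by apply/funext => x /=; rewrite tuple_consK.
Qed.

HB.instance Definition _ := Measure_isSigmaFinite.Build _ _ _
  (tuple_step m) step_sigma_finite.

Definition tuple_step_measure :
  {sigma_finite_measure set (n.+1.-tuple T) -> \bar R} := tuple_step m.

End step.

Let lebesgue_tuple_ex n :
  exists m : {sigma_finite_measure set (n.-tuple T) -> \bar R},
    @lebesgue_tuple n = m.
Proof.
elim: n => [|n [m IH]]; first by exists (dirac [tuple]).
by exists (tuple_step_measure m); rewrite /= IH.
Qed.

Section instances.
Context (n : nat).

Let lebesgue_tuple0 : @lebesgue_tuple n set0 = 0%E.
Proof. by have [m ->] := lebesgue_tuple_ex n. Qed.

Let lebesgue_tuple_ge0 A : (0 <= @lebesgue_tuple n A)%E.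
Proof. by have [m ->] := lebesgue_tuple_ex n. Qed.

Let lebesgue_tuple_sigma_additive : semi_sigma_additive (@lebesgue_tuple n).
Proof.
by have [m ->] := lebesgue_tuple_ex n; exact: measure_semi_sigma_additive.
Qed.

HB.instance Definition _ := isMeasure.Build _ _ _ (@lebesgue_tuple n)
  lebesgue_tuple0 lebesgue_tuple_ge0 lebesgue_tuple_sigma_additive.

Let lebesgue_tuple_sigma_finite : sigma_finite setT (@lebesgue_tuple n).
Proof. by have [m ->] := lebesgue_tuple_ex n; exact: sigma_finiteT. Qed.

HB.instance Definition _ := Measure_isSigmaFinite.Build _ _ _
  (@lebesgue_tuple n) lebesgue_tuple_sigma_finite.

End instances.

Lemma lebesgue_tuple_box n (A : 'I_n -> set T) : (forall i, measurable (A i)) ->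
  lebesgue_tuple [set t : n.-tuple T | forall i, A i (tnth t i)] =
  (\prod_(i < n) lebesgue_measure (A i))%E.
Proof.
elim: n A => [|n IH] A mA.
  by rewrite big_ord0 /= diracE mem_set//= => -[].
rewrite big_ord_recl -IH//= /pushforward -product_measure1E//; last first.
  rewrite (_ : mkset _ = \bigcap_(i in [set: 'I_n])
      ((fun t : n.-tuple T => tnth t i) @^-1` A (lift ord0 i))); last first.
    by apply/seteqP; split=> t /= At i; [move=> _|]; exact: At.
  apply: fin_bigcap_measurable => // i _.
  by rewrite -[X in measurable X]setTI; exact: measurable_tnth.
congr (product_measure1 _ _ _); apply/seteqP; split=> -[x t]/=.
  move=> At; split; first exact: (At ord0).
  by move=> i; have := At (lift ord0 i); rewrite tnthS.
case=> Ax At i; have [j ->|->] := unliftP ord0 i; last exact: Ax.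
by rewrite tnthS; exact: At.
Qed.

End lebesgue_tuple.

Section graphon.
Context {R : realType}.
Local Notation T := (measurableTypeR R).

Definition I01 : set T := `[0, 1]%classic.

(* A graphon is a total function on R * R of which only the restriction to
   [0,1]^2 is meaningful; likewise for the functions h below. *)
Definition is_graphon (W : T * T -> R) : Prop :=
  [/\ measurable_fun (I01 `*` I01) W,
      forall x y, I01 x -> I01 y -> W (x, y) = W (y, x) &
      forall x y, I01 x -> I01 y -> 0 <= W (x, y) <= 1].

Definition is_two_type_graphon (W : T * T -> R) : Prop :=
  is_graphon W /\
  exists S : 'I_2 -> set T,
    [/\ forall i, measurable (S i),
        S ord0 `|` S ord_max = I01,
        S ord0 `&` S ord_max = set0 &
        forall i j, exists c, forall x y, S i x -> S j y -> W (x, y) = c].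

Definition constant_graphon (W : T * T -> R) : Prop :=
  exists c, forall x y, I01 x -> I01 y -> W (x, y) = c.

Definition ae_constant_graphon (W : T * T -> R) : Prop :=
  exists c, {ae (lebesgue_measure \x lebesgue_measure)%E,
    forall z : T * T, (I01 `*` I01) z -> W z = c}.

Definition ae_zero (h : T -> R) : Prop :=
  {ae lebesgue_measure, forall x : T, I01 x -> h x = 0}.

End graphon.

(* The index set {(i, j) : 1 <= i < j <= m} of the variables w_ij. *)
Definition edge (m : nat) : Type := {e : 'I_m * 'I_m | (e.1 < e.2)%N}.

Section Phi.
Context {R : realType} {m : nat}.
Local Notation T := (measurableTypeR R).

Definition cube : set {ptws edge m -> R} := [set w | forall e, 0 <= w e <= 1].

Definition Phi_graphon (Phi : {ptws edge m -> R} -> R) (W : T * T -> R)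
    (x : m.-tuple T) : R :=
  Phi (fun e => W (tnth x (val e).1, tnth x (val e).2)).

Definition subset_weights (u v s : R) (A : {set 'I_m}) : {ptws edge m -> R} :=
  fun e => let: (i, j) := val e in
    if (i \in A) && (j \in A) then u
    else if (i \notin A) && (j \notin A) then v
    else s.

End Phi.

(* Main.v *)
Require Import Defs.
From mathcomp Require Import all_boot all_order all_algebra all_fingroup.
From mathcomp Require Import all_classical all_reals all_analysis.
From mathcomp Require Import measurable_realfun lra.

Import Order.TTheory GRing.Theory Num.Theory.
Import numFieldNormedType.Exports.

Set Implicit Arguments.
Unset Strict Implicit.
Unset Printing Implicit Defensive.

Local Open Scope classical_set_scope.
Local Open Scope ring_scope.

(** The hard implication is (i) => (iii).  Let U, V range over the ultrafilters
on [0,1] that contain all conull sets, and put a_U = lim_U h and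
s_UV = lim_(x -> U) lim_(y -> V) W(x, y).  By Fubini the a.e. identity survives
iterated limits, and continuity of Phi turns it into
  Phi(weights u = s_UU, v = s_VV, s = s_UV for A) = |A| a_U + (m - |A|) a_V,
that is, (iii) unless u = v = s or a_U = a_V = 0.  Suppose that (iii) fails for
all U, V.  Then all a_U agree (compare A empty with A full), and they are
nonzero because h is not a.e. 0; hence all s_UV equal one constant c.  Finally,
if y is a Lebesgue point of W(x, .) for a.e. x and V refines the filter of sets
of density 1 at y, then lim_V W(x, .) = W(x, y) for a.e. x, so W(., y) = c a.e.;
almost every y is such a point, and W = c a.e. *)

(** * Iterated filter limits *)

Section ultrafilter_limits.
Context {R : realType}.

(** The iterated limit lim_(x -> F) lim_(y -> G) f(x, y) = c, phrased so that the inner limits need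
    not exist. *)
Definition near2 (S T : Type) (F : set_system S) (G : set_system T)
    (f : S * T -> R) (c : R) :=
  forall e : R, 0 < e -> F [set x | G [set y | `|f (x, y) - c| < e]].

(** By compactness of [a, b] the image filter clusters at some [c]; since an ultrafilter contains
    each set or its complement, it converges to [c]. *)
Lemma ultra_lim (T : Type) (F : set_system T) (f : T -> R) (a b : R) :
  UltraFilter F -> F [set x | a <= f x <= b] ->
  exists2 c, a <= c <= b & forall e : R, 0 < e -> F [set x | `|f x - c| < e].
Proof.
move=> UF Fab.
have [|c [cab cl]] := @segment_compact R a b (f @ F) _.
  by apply: (@filterS _ F _ _ _ _ Fab) => x /=; rewrite in_itv.
exists c => [|e e0]; first by move: cab; rewrite /= in_itv.
have [//|FC] := in_ultra_setVsetC [set x | `|f x - c| < e] UF.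
have fC : (f @ F) [set y | ~ `|y - c| < e] by exact: FC.
have nc : nbhs c [set y | `|c - y| < e] by apply: (@nbhsx_ballx _ _ c e).
have [y [/= yc]] := cl _ _ fC nc.
by rewrite distrC => /yc.
Qed.

Lemma ultra_lim2 (S T : Type) (F : set_system S) (G : set_system T)
    (f : S * T -> R) (a b : R) :
  UltraFilter F -> UltraFilter G ->
  F [set x | G [set y | a <= f (x, y) <= b]] ->
  exists2 c, a <= c <= b & near2 F G f c.
Proof.
move=> UF UG FG.
pose P x c := a <= c <= b /\ forall e : R, 0 < e -> G [set y | `|f (x, y) - c| < e].
(* [g x] is the inner limit. Where the bound fails its value is arbitrary, since such [x] lie
   outside a member of [F]. *)
have /choice[g gP] : forall x, exists c,
    G [set y | a <= f (x, y) <= b] -> P x c.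
  move=> x; have [Gx|nGx] := pselect (G [set y | a <= f (x, y) <= b]).
    by have [c ? ?] := ultra_lim UG Gx; exists c.
  by exists 0 => /nGx.
have [|c cab gc] := @ultra_lim _ F g a b UF; first by apply: filterS FG => x /gP[].
exists c => // e e0; have e2 : 0 < e / 2 by rewrite divr_gt0.
apply: filterS2 FG (gc _ e2) => x /gP[_ /(_ _ e2) Gx] /= gxc.
apply: filterS Gx => y /= fxy.
by have := ler_distD (g x) (f (x, y)) c; lra.
Qed.

End ultrafilter_limits.

Section iterated_filters.
Context {T : Type}.

(* The quantifier for coordinate 0 is the outermost one. *)
Fixpoint iter_near n (F : nat -> set_system T) : (n.-tuple T -> Prop) -> Prop :=
  match n with
  | 0 => fun P => P [tuple]
  | n'.+1 => fun P => F 0 [set x | @iter_near n' (fun i => F i.+1)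
                                     (fun t => P [tuple of x :: t])]
  end.

Implicit Type F : nat -> set_system T.

Lemma iter_nearS n F (P Q : n.-tuple T -> Prop) : (forall i, Filter (F i)) ->
  (forall t, P t -> Q t) -> iter_near F P -> iter_near F Q.
Proof.
elim: n F P Q => [|n IH] F P Q FF PQ /=; first exact: PQ.
by apply: filterS => x; apply: IH => // t; exact: PQ.
Qed.

Lemma iter_nearI n F (P Q : n.-tuple T -> Prop) : (forall i, Filter (F i)) ->
  iter_near F P -> iter_near F Q -> iter_near F (fun t => P t /\ Q t).
Proof.
elim: n F P Q => [|n IH] F P Q FF //=.
by apply: filterS2 => x Px Qx; exact: IH.
Qed.

Lemma iter_near_ex n F (P : n.-tuple T -> Prop) :
  (forall i, ProperFilter (F i)) -> iter_near F P -> exists t, P t.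
Proof.
elim: n F P => [|n IH] F P FF /=; first by exists [tuple].
by move=> /filter_ex[x] /(IH _ _ (fun i => FF i.+1))[t Pt]; exists [tuple of x :: t].
Qed.

Lemma iter_near_tnth n F (Q : nat -> T -> Prop) : (forall i, Filter (F i)) ->
  (forall i, (i < n)%N -> F i (Q i)) ->
  iter_near F (fun t : n.-tuple T => forall i : 'I_n, Q i (tnth t i)).
Proof.
elim: n F Q => [|n IH] F Q FF FQ /=; first by case.
apply: filterS (FQ 0%N isT) => x Qx.
have := IH (fun i => F i.+1) (fun i => Q i.+1) (fun i => FF i.+1)
  (fun i (ilt : (i < n)%N) => FQ i.+1 ilt).
apply: iter_nearS => // t Qt i.
case: (unliftP ord0 i) => [j ->|-> //]; rewrite tnthS; exact: Qt.
Qed.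

(** The outermost value [x] can be chosen good for all of the finitely many later indices at once.
    Its conditions on the remaining coordinates then become unary, and the pairs among those are
    left to induction. *)
Lemma iter_near_tnth2 n F (Q : nat -> nat -> T -> T -> Prop) :
  (forall i, Filter (F i)) ->
  (forall i j, (i < j < n)%N -> F i [set x | F j [set y | Q i j x y]]) ->
  iter_near F (fun t : n.-tuple T =>
    forall i j : 'I_n, (i < j)%N -> Q i j (tnth t i) (tnth t j)).
Proof.
elim: n F Q => [|n IH] F Q FF FQ /=; first by case.
have F0 : F 0 [set x | forall j : 'I_n, F j.+1 [set y | Q 0%N j.+1 x y]].
  apply: filter_forall => j.
  by apply: FQ => /=; rewrite ltnS ltn_ord.
apply: filterS F0 => x Qx.
have QS i j : (i < j < n)%N -> F i.+1 [set x | F j.+1 [set y | Q i.+1 j.+1 x y]].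
  by move=> ij; exact: FQ.
have FF' i : Filter (F i.+1) by [].
have := IH (fun i => F i.+1) (fun i j => Q i.+1 j.+1) FF' QS.
have Q0 : forall i, (i < n)%N -> F i.+1 (Q 0%N i.+1 x).
  by move=> i ilt; exact: (Qx (Ordinal ilt)).
move=> /(iter_nearI FF' (iter_near_tnth FF' Q0)); apply: iter_nearS => // t.
case=> Qt Qtt i j.
case: (unliftP ord0 j) => [j' ->|->]; last by rewrite ltn0.
case: (unliftP ord0 i) => [i' ->|-> _]; rewrite !tnthS; first exact: Qtt.
exact: Qt.
Qed.

End iterated_filters.

(** * Null sets of products and tuples *)

Section null_sections.
Context d1 d2 (T1 : measurableType d1) (T2 : measurableType d2) (R : realType).
Variables (m1 : {sigma_finite_measure set T1 -> \bar R})
          (m2 : {sigma_finite_measure set T2 -> \bar R}).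

(** The product measure is the integral of the measures of the x-sections, and a nonnegative
    function has integral 0 iff it vanishes a.e. *)
Lemma null_xsection (A : set (T1 * T2)) : measurable A ->
  (m1 \x m2)%E A = 0%E <-> {ae m1, forall x, m2 (xsection A x) = 0%E}.
Proof.
move=> mA.
have mf := measurable_fun_xsection m2 mA.
have := ae_eq_integral_abs m1 measurableT mf.
rewrite /product_measure1.
under eq_integral do rewrite gee0_abs//.
move=> ->; split; apply: filterS => x; [by apply|by []].
Qed.

(** Since the product measure is defined through x-sections, Tonelli is applied first. *)
Lemma null_ysection (A : set (T1 * T2)) : measurable A ->
  (m1 \x m2)%E A = 0%E <-> {ae m2, forall y, m1 (ysection A y) = 0%E}.
Proof.
move=> mA.
have mf := measurable_fun_ysection m1 mA.
have := ae_eq_integral_abs m2 measurableT mf.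
have := indic_fubini_tonelli m1 m2 mA.
rewrite indic_fubini_tonelli_FE// indic_fubini_tonelli_GE// /product_measure1.
move=> ->; under eq_integral do rewrite gee0_abs//.
move=> ->; split; apply: filterS => x; [by apply|by []].
Qed.

Lemma ae_xsection (P : T1 * T2 -> Prop) : {ae (m1 \x m2)%E, forall z, P z} ->
  {ae m1, forall x, {ae m2, forall y, P (x, y)}}.
Proof.
move=> [A [mA /(null_xsection mA) A0 PA]].
apply: filterS A0 => x Ax0; exists (xsection A x); split => //.
  exact: measurable_xsection.
by move=> y /= nP; rewrite /xsection/= inE; apply: PA.
Qed.

Lemma ae_ysection (P : T1 * T2 -> Prop) : {ae (m1 \x m2)%E, forall z, P z} ->
  {ae m2, forall y, {ae m1, forall x, P (x, y)}}.
Proof.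
move=> [A [mA /(null_ysection mA) A0 PA]].
apply: filterS A0 => y Ay0; exists (ysection A y); split => //.
  exact: measurable_ysection.
by move=> x /= nP; rewrite /ysection/= inE; apply: PA.
Qed.

End null_sections.

(** * Lebesgue measure on tuples: iterated filters and permutations of coordinates *)

Section tuples.
Context {R : realType}.
Local Notation T := (measurableTypeR R).

(** Fubini, one coordinate at a time: each a.e. quantifier may be weakened to a filter containing
    the conull sets. *)
Lemma ae_iter_near n (F : nat -> set_system T) (P : n.-tuple T -> Prop) :
  (forall i, Filter (F i)) ->
  (forall i, almost_everywhere lebesgue_measure `<=` F i) ->
  {ae @lebesgue_tuple R n, forall t, P t} -> iter_near F P.
Proof.
elim: n F P => [|n IH] F P FF aeF.
  (* In dimension 0 the measure is a Dirac mass, so a null set misses the empty tuple. *)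
  move=> [A [mA A0 PA]] /=; apply: contrapT => nP.
  have : A [tuple] by apply: PA.
  by move: A0; rewrite /= diracE => /eqP; rewrite eqe pnatr_eq0 eqb0 notin_setE.
move=> [A [mA A0 PA]] /=; apply: (aeF 0%N).
have : {ae (lebesgue_measure \x @lebesgue_tuple R n)%E, forall z : T * n.-tuple T,
    P (tuple_cons z)}.
  exists (@tuple_cons R n @^-1` A); split => //.
    by rewrite -[X in measurable X]setTI; exact: measurable_tuple_cons.
  by move=> z /= nP; apply: PA.
move=> /ae_xsection; apply: filterS => x.
exact: (IH (fun i => F i.+1) _ (fun i => FF i.+1) (fun i => aeF i.+1)).
Qed.

Definition perm_tuple n (s : 'S_n) (t : n.-tuple T) : n.-tuple T :=
  [tuple tnth t (s i) | i < n].

Lemma measurable_perm_tuple n (s : 'S_n) : measurable_fun setT (perm_tuple s).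
Proof.
apply/measurable_fun_tnthP => i.
rewrite (_ : _ \o _ = (@tnth _ T ^~ (s i))); first exact: measurable_tnth.
by apply/funext => t /=; rewrite tnth_mktuple.
Qed.

Definition box n (A : 'I_n -> set T) : set (n.-tuple T) :=
  [set t | forall i, A i (tnth t i)].

Lemma measurable_box n (A : 'I_n -> set T) :
  (forall i, measurable (A i)) -> measurable (box A).
Proof.
move=> mA.
rewrite (_ : box A = \bigcap_(i in [set: 'I_n]) ((@tnth _ T ^~ i) @^-1` A i)).
  apply: fin_bigcap_measurable => // i _.
  by rewrite -[X in measurable X]setTI; exact: measurable_tnth.
by apply/seteqP; split=> t /= At i; [move=> _|]; exact: At.
Qed.

Definition boxes n : set (set (n.-tuple T)) :=
  [set B | exists2 A : 'I_n -> set T, (forall i, measurable (A i)) & B = box A].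

(** Boxes replace the generating cylinders because they are closed under intersection, as uniqueness
    of measures requires. *)
Lemma measurable_boxes n : @measurable _ (n.-tuple T) = <<s @boxes n >>.
Proof.
apply/seteqP; split.
  apply: smallest_sub; first exact: smallest_sigma_algebra.
  move=> X; rewrite -bigcup_seq => -[i _ [A mA <-]].
  apply: sub_sigma_algebra.
  exists (fun j => if j == i then A else setT) => [j|].
    by case: ifP.
  apply/seteqP; split => t /=.
    by case=> _ At j; case: eqP => // ->.
  by move=> /(_ i); rewrite eqxx.
apply: smallest_sub; first exact: sigma_algebra_measurable.
by move=> _ [A mA ->]; exact: measurable_box.
Qed.

Lemma lebesgue_box n (A : 'I_n -> set T) : (forall i, measurable (A i)) ->
  lebesgue_tuple (box A) = (\prod_(i < n) lebesgue_measure (A i))%E.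
Proof. exact: lebesgue_tuple_box. Qed.

(** Both sides are measures of [A] that agree on boxes, where the product of side lengths ignores
    their order. The cubes [-k, k]^n have finite measure and exhaust the space, so the measures
    coincide. *)
Lemma lebesgue_tuple_perm n (s : 'S_n) (A : set (n.-tuple T)) : measurable A ->
  lebesgue_tuple (perm_tuple s @^-1` A) = lebesgue_tuple A.
Proof.
move=> mA.
pose g k : set (n.-tuple T) := box (fun=> `[- k%:R, k%:R]%classic).
have goo k : (lebesgue_tuple (g k) < +oo)%E.
  rewrite lebesgue_box//.
  rewrite (eq_bigr (fun=> (k%:R + k%:R)%:E)).
    by rewrite prodEFin ltry.
  move=> i _; rewrite lebesgue_measure_itv/= lte_fin.
  case: ltP => [_|]; first by rewrite -EFinB opprK.
  (* The length formula is conditional on -k < k, which fails only for k = 0. *)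
  move=> kk; have -> : k = 0%N; last by rewrite addr0.
  have k0 : 0 <= k%:R :> R by [].
  by apply/eqP; rewrite -(@pnatr_eq0 R); apply/eqP; lra.
apply/esym.
apply: (@measure_unique _ _ _ (@boxes n) g _ _ _ _ (@lebesgue_tuple R n)
  (pushforward (@lebesgue_tuple R n) (perm_tuple s))) => //.
- exact: measurable_boxes.
- move=> _ _ [B mB ->] [C mC ->]; exists (fun i => B i `&` C i).
    by move=> i; exact: measurableI.
  apply/seteqP; split => t /=; first by move=> [Bt Ct] i; split.
  by move=> BCt; split=> i; case: (BCt i).
- by move=> k; eexists; last reflexivity.
- apply/seteqP; split=> // t _.
  exists (\max_(i < n) (Num.truncn `|tnth t i|).+1)%N => //= i.
  rewrite /= in_itv/= -ler_norml.
  apply: (@le_trans _ _ (Num.truncn `|tnth t i|).+1%:R).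
    exact/ltW/truncnS_gt.
  by rewrite ler_nat; exact: (@leq_bigmax _ (fun i => (Num.truncn `|tnth t i|).+1)).
- exact: measurable_perm_tuple.
- move=> ? _ [B mB ->]; apply: (etrans (lebesgue_box mB)).
  have E : perm_tuple s @^-1` box B = box (fun i => B ((s^-1)%g i)).
    apply/seteqP; split => t /= Bt i.
      by have := Bt ((s^-1)%g i); rewrite tnth_mktuple permKV.
    by have := Bt (s i); rewrite tnth_mktuple permK.
  apply/esym; apply: (etrans (congr1 (@lebesgue_tuple R n) E)).
  apply: (etrans (lebesgue_box _)) => //.
  rewrite (reindex_inj (@perm_inj _ s))/=.
  by apply: eq_bigr => i _; rewrite permK.
Qed.

Lemma ae_perm_tuple n (s : 'S_n) (P : n.-tuple T -> Prop) :
  {ae @lebesgue_tuple R n, forall t, P t} ->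
  {ae @lebesgue_tuple R n, forall t, P (perm_tuple s t)}.
Proof.
move=> [A [mA A0 PA]]; exists (perm_tuple s @^-1` A); split.
- by rewrite -[X in measurable X]setTI; exact: measurable_perm_tuple.
- by have := lebesgue_tuple_perm s mA; rewrite A0.
- by move=> t /= nP; apply: PA.
Qed.

End tuples.

(** * Configurations of two ultrafilters *)

(** List [A] first and its complement after it; the permutation sends each index to its position in
    this list. *)
Lemma perm_initial_segment m (A : {set 'I_m}) :
  exists s : 'S_m, forall i, (i \in A) = (s i < #|A|)%N.
Proof.
pose r := enum A ++ enum (~: A).
have inr i : i \in r by rewrite mem_cat !mem_enum inE orbN.
have sr : size r = m by rewrite size_cat -!cardE cardsC card_ord.
have ltm i : (index i r < m)%N by rewrite -[X in (_ < X)%N]sr index_mem.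
have inj : injective (fun i => Ordinal (ltm i)).
  move=> i j [ij]; rewrite -(nth_index i (inr i)) -(nth_index i (inr j)).
  by rewrite ij.
exists (perm inj) => i; rewrite permE /= index_cat mem_enum.
case: ifP => iA; first by rewrite cardE index_mem mem_enum.
by rewrite cardE ltnNge leq_addr.
Qed.

(** * Continuity and boundedness of Phi on the cube *)

Section cube.
Context {R : realType} {m : nat}.
Variable Phi : {ptws edge m -> R} -> R.
Hypothesis Phi_cont : {within cube, continuous Phi}.

(** The filter generated by uniform boxes around [w0] converges to [w0] in every coordinate, hence
    pointwise, so it contains [U]. *)
Lemma nbhs_ptws_box (w0 : {ptws edge m -> R}) (U : set {ptws edge m -> R}) :
  nbhs w0 U -> exists2 d : R, 0 < d &
    [set w : {ptws edge m -> R} | forall i, `|w i - w0 i| < d] `<=` U.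
Proof.
pose G : set_system {ptws edge m -> R} := filter_from [set d : R | 0 < d]
  (fun d => [set w | forall i, `|w i - w0 i| < d]).
have GF : Filter G.
  apply: filter_from_filter => [|d1 d2 /= d10 d20]; first by exists 1 => /=.
  exists (Num.min d1 d2) => /= [|w wd]; first by rewrite lt_min d10.
  by split=> i; have := wd i; rewrite lt_min => /andP[].
suff : G --> w0 by apply.
apply/cvg_sup => i V.
rewrite nbhsE => -[_ [[C oC <-] Cw0] CV].
have /nbhs_ballP[d /= d0 dC] : nbhs (w0 i) C by apply: open_nbhs_nbhs.
exists d => //= w wd; apply: CV; apply: dC.
by rewrite /ball/= distrC.
Qed.

Lemma cube_continuousP (w0 : {ptws edge m -> R}) (e : R) : cube w0 -> 0 < e ->
  exists2 d : R, 0 < d & forall w, cube w ->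
    (forall i, `|w i - w0 i| < d) -> `|Phi w - Phi w0| < e.
Proof.
move=> w01 e0; have := (subspace_continuousP cube Phi).1 Phi_cont w0 w01.
move=> /cvgrPdist_lt/(_ e e0) /nbhs_ptws_box[d d0 dU]; exists d => // w w1 wd.
by rewrite distrC; apply: dU.
Qed.

(** The cube is compact by Tychonoff. *)
Lemma cube_bounded : exists M : R, forall w, cube w -> `|Phi w| <= M.
Proof.
have cc : compact (@cube R m).
  have E : @cube R m = [set f | forall e : edge m, `[0, 1]%classic (f e)].
    by apply/seteqP; split=> w /= w1 e; have := w1 e; rewrite /= in_itv.
  rewrite E.
  exact: (@tychonoff {e : 'I_m * 'I_m | (e.1 < e.2)%N} (fun=> R)
    (fun=> `[0, 1]%classic) (fun=> @segment_compact R 0 1)).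
have /compact_bounded[M [_ MP]] := continuous_compact Phi_cont cc.
exists (M + 1) => w w1; apply: MP; first by rewrite ltrDl.
by exists w.
Qed.

End cube.

Section configurations.
Context {R : realType} {m : nat}.
Local Notation T := (measurableTypeR R).
Variables (Phi : {ptws edge m -> R} -> R) (W : T * T -> R) (h : T -> R).
Hypotheses (Phi_cont : {within cube, continuous Phi}) (gW : is_graphon W).
Hypothesis Phi_sum : {ae @lebesgue_tuple R m, forall x : m.-tuple T,
  (forall i, I01 (tnth x i)) -> Phi_graphon Phi W x = \sum_(i < m) h (tnth x i)}.

(** Conull refers to the whole line, hence the separate condition [U I01]. *)
Definition ae_ultra (U : set_system T) :=
  [/\ UltraFilter U, almost_everywhere lebesgue_measure `<=` U & U I01].

(* The iterated limits over U and V need not commute, so the coordinates in A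
   must all be quantified (over U) before the others (over V): this is why the
   tuple is permuted to make A an initial segment. *)
Lemma ultra_configuration (U V : set_system T) (u v s a b : R) (A : {set 'I_m}) :
  ae_ultra U -> ae_ultra V ->
  0 <= u <= 1 -> 0 <= v <= 1 -> 0 <= s <= 1 ->
  near2 U U W u -> near2 V V W v -> near2 U V W s ->
  (forall e : R, 0 < e -> U [set x | `|h x - a| < e]) ->
  (forall e : R, 0 < e -> V [set x | `|h x - b| < e]) ->
  Phi (subset_weights u v s A) = m%:R * b + (a - b) * #|A|%:R.
Proof.
move=> [UU aeU UI] [UV aeV VI] u01 v01 s01 Uu Vv UVs Ua Vb.
have [p pA] := perm_initial_segment A; set k := #|A| in pA *.
(* After the permutation, the first [k] coordinates follow [U] and the others [V]. The limits
   [c i j] are used only for i < j, so j < k already puts both coordinates in the first block. *)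
pose F i := if (i < k)%N then U else V.
pose c i j := if (j < k)%N then u else if (i < k)%N then s else v.
pose g i := if (i < k)%N then a else b.
have FU i : UltraFilter (F i) by rewrite /F; case: ifP.
have FP i : ProperFilter (F i) by exact: ultra_proper.
have FF i : Filter (F i) by exact: filter_filter.
have aeF i : almost_everywhere lebesgue_measure `<=` F i.
  by rewrite /F; case: ifP.
have FI i : F i I01 by rewrite /F; case: ifP.
have Fg i (e : R) : 0 < e -> F i [set x | `|h x - g i| < e].
  by rewrite /F /g; case: ifP => _; [exact: Ua|exact: Vb].
have Fc i j : (i < j)%N -> near2 (F i) (F j) W (c i j).
  move=> ij; rewrite /F /c; have [jk|kj] := ltnP j k; last by case: ifP.
  by rewrite (ltn_trans ij jk).
have sum_g : \sum_(i < m) g (p i) = m%:R * b + (a - b) * k%:R.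
  transitivity (\sum_(i < m) (b + (if i \in A then a - b else 0))).
    apply: eq_bigr => i _; rewrite /g -pA; case: ifP => _; last by rewrite addr0.
    by rewrite addrC subrK.
  rewrite big_split/= sumr_const card_ord -big_mkcond/= sumr_const.
  by rewrite mulr_natl mulr_natr.
have sw01 : cube (subset_weights u v s A).
  by move=> e; rewrite /subset_weights; case: (val e) => i j; do 2?case: ifP.
have [mW symW W01] := gW.
(* Suppose that the two sides are at distance e > 0; one tuple close enough to all the limits will
   give a contradiction. *)
rewrite -sum_g; apply/eqP; rewrite -subr_eq0 -normr_eq0; apply/negPn/negP.
rewrite normr_eq0 -normr_gt0; set e := `|_| => e0.
have e2 : 0 < e / 2 by rewrite divr_gt0.
have [d1 d10 d1P] := cube_continuousP Phi_cont sw01 e2.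
(* [d1] keeps the error in [Phi] below e / 2, and the other bound keeps the total error of the [m]
   values of [h] at most e / 2. Dividing by m + 1 avoids a zero denominator. *)
pose d := Num.min d1 (e / 2 / m.+1%:R).
have d0 : 0 < d by rewrite lt_min d10 divr_gt0.
(* The a.e. identity at the permuted tuple, membership in [0,1] and closeness of [h] and [W] to
   their limits hold together along the iterated filters; properness then yields an actual tuple. *)
have Fall := iter_nearI FF
  (iter_nearI FF (ae_iter_near FF aeF (ae_perm_tuple p Phi_sum))
    (@iter_near_tnth _ m F (fun=> I01) FF (fun i _ => FI i)))
  (iter_nearI FF
    (@iter_near_tnth _ m F (fun i x => `|h x - g i| < d) FF
      (fun i _ => Fg i d d0))
    (@iter_near_tnth2 _ m F (fun i j x y => `|W (x, y) - c i j| < d) FF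
      (fun i j ij => Fc i j (andP ij).1 d d0))).
have [t [[tsum t01] [tg tc]]] := iter_near_ex FP Fall.
set x := perm_tuple p t in tsum.
have xE i : tnth x i = tnth t (p i) by rewrite tnth_mktuple.
have x01 i : I01 (tnth x i) by rewrite xE.
pose w : {ptws edge m -> R} := fun e => W (tnth x (val e).1, tnth x (val e).2).
have w01 : cube w by move=> ?; exact: W01.
have wd1 i : `|w i - subset_weights u v s A i| < d1.
  apply: (@lt_le_trans _ _ d); last by rewrite ge_min lexx.
  rewrite /w /subset_weights; case: i => -[i j] /= ij; rewrite !xE !pA.
  have pij : p i != p j by rewrite (inj_eq perm_inj) neq_ltn ij.
  have {pij} : (p i < p j)%N || (p j < p i)%N by rewrite -neq_ltn.
  (* The permutation may reverse the order of an edge; symmetry of [W] restores it. *)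
  move=> /orP[pij|pij]; last rewrite symW//.
    have := tc _ _ pij; rewrite /c.
    have [jk|kj] := ltnP (p j) k; first by rewrite (ltn_trans pij jk).
    by have [ik|ki] := ltnP (p i) k.
  have := tc _ _ pij; rewrite /c.
  have [ik|ki] := ltnP (p i) k; first by rewrite (ltn_trans pij ik).
  by have [jk|kj] := ltnP (p j) k.
have wsum : `|Phi w - \sum_(i < m) g (p i)| <= m%:R * d.
  have -> : Phi w = \sum_(i < m) h (tnth x i) by exact: tsum.
  rewrite -sumrB (le_trans (ler_norm_sum _ _ _))//.
  apply: (@le_trans _ _ (\sum_(i < m) d)).
    by apply: ler_sum => i _; rewrite xE; exact/ltW/tg.
  by rewrite sumr_const card_ord mulr_natl.
have md : m%:R * d <= e / 2.
  have m1 : 0 < m.+1%:R :> R by [].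
  have dle : d * m.+1%:R <= e / 2 by rewrite -ler_pdivlMr// ge_min lexx orbT.
  by move: dle; rewrite -natr1; have := ltW d0; lra.
have := d1P w w01 wd1; rewrite distrC => lt1.
have := ler_distD (Phi w) (Phi (subset_weights u v s A)) (\sum_(i < m) g (p i)).
by rewrite -/e; lra.
Qed.

End configurations.

(** * Lebesgue points of slices *)

Section density_filter.
Context {R : realType}.
Local Notation T := (measurableTypeR R).
Local Notation mu := (@lebesgue_measure R).
Implicit Types (y : T) (A B : set T).

(** Density 0 of [B] at [y], tested along the radii 1/(n+1). *)
Definition thin_at y B := forall e : R, 0 < e ->
  \forall n \near \oo, (mu (B `&` ball y n.+1%:R^-1) <= (e * n.+1%:R^-1)%:E)%E.

(** The sets of density 1 at [y]; the measurable cover [B] of the complement admits nonmeasurable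
    members. *)
Definition density_filter y : set_system T :=
  [set A | exists B, [/\ measurable B, ~` A `<=` B & thin_at y B]].

Lemma density_filter_proper y : ProperFilter (density_filter y).
Proof.
split; last split.
(* The whole line is not thin: a ball of radius r has measure 2r > r. *)
- move=> [B [mB]]; rewrite setC0 subTset => -> /(_ 1 ltr01) [n _ /(_ n (leqnn n))].
  rewrite setTI /= lebesgue_measure_ball// lee_fin mul1r.
  by apply/negP; rewrite -ltNge mulr2n ltrDl.
- exists set0; split => //; first by rewrite setCT.
  move=> e e0; apply: nearW => n; rewrite set0I measure0 lee_fin.
  by rewrite mulr_ge0// ltW.
- move=> A1 A2 [B1 [mB1 AB1 tB1]] [B2 [mB2 AB2 tB2]].
  exists (B1 `|` B2); split; first exact: measurableU.
    by rewrite setCI; exact: setUSS.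
  move=> e e0; have e2 : 0 < e / 2 by rewrite divr_gt0.
  near=> n; rewrite setIUl (le_trans (measureU2 _ _ _))//.
  + by apply: measurableI => //; exact: measurable_ball.
  + by apply: measurableI => //; exact: measurable_ball.
  rewrite [in leRHS](splitr e) mulrDl EFinD; apply: leeD; near: n;
    [exact: tB1|exact: tB2].
- move=> A1 A2 A12 [B [mB AB tB]]; exists B; split => //.
  by apply: subset_trans AB; exact: subsetC.
Unshelve. all: by end_near. Qed.

Lemma ae_density_filter y : almost_everywhere mu `<=` density_filter y.
Proof.
move=> A [B [mB B0 AB]]; exists B; split => // e e0.
apply: nearW => n; rewrite (@le_trans _ _ 0%E)//.
  rewrite -B0 le_measure ?inE//.
  by apply: measurableI => //; exact: measurable_ball.
by rewrite lee_fin mulr_ge0// ltW.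
Qed.

Lemma density_filter_I01 y : 0 < y < 1 -> density_filter y I01.
Proof.
have itv01 (a b r : R) :
    r < a -> r < 1 - a -> - r < a - b -> a - b < r -> 0 <= b <= 1.
  by move=> *; apply/andP; split; lra.
move=> /andP[y0 y1]; exists (~` I01); split => //.
  by apply: measurableC; exact: measurable_itv.
move=> e e0; near=> n.
rewrite (_ : _ `&` _ = set0).
  by rewrite measure0 lee_fin mulr_ge0// ltW.
apply/seteqP; split=> // z [/= nz]; rewrite /ball/= => yz; apply: nz.
have ry : n.+1%:R^-1 < Num.min y (1 - y).
  by near: n; apply: near_infty_natSinv_lt (PosNum _); rewrite lt_min y0 subr_gt0.
rewrite /I01/= in_itv/=; move: ry yz; rewrite lt_min => /andP[ry1 ry2].
rewrite ltr_norml => /andP[yz1 yz2]; exact: itv01 ry1 ry2 yz1 yz2.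
Unshelve. all: by end_near. Qed.

End density_filter.

Section lebesgue_points.
Context {R : realType}.
Local Notation T := (measurableTypeR R).
Local Notation mu := (@lebesgue_measure R).
Variable f : T * T -> R.
Hypothesis mf : measurable_fun setT f.
Hypothesis lf : forall x, locally_integrable setT (fun y => f (x, y)).

(** At (x, y), the mean of |f(x, t) - f(x, y)| over t within 1/(n+1) of y. *)
Definition slice_davg n (z : T * T) : \bar R :=
  davg (fun y => f (z.1, y)) z.2 n.+1%:R^-1.

(** Up to the factor 1/(2r), this is the integral over the last variable of a jointly measurable
    nonnegative function of (x, y, t), so Tonelli applies. *)
Lemma measurable_slice_davg n : measurable_fun setT (slice_davg n).
Proof.
pose r : R := n.+1%:R^-1.
pose g (p : (T * T) * T) : R :=
  if `|p.1.2 - p.2| < r then `|f (p.1.1, p.2) - f (p.1.1, p.1.2)| else 0.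
have mg : measurable_fun setT g.
  apply: measurable_fun_ifT => //.
    apply: measurable_fun_ltr => //; apply: measurableT_comp => //.
    apply: measurable_funB => //.
    exact: (measurableT_comp measurable_snd measurable_fst).
  apply: measurableT_comp => //; apply: measurable_funB.
    apply: (measurableT_comp mf); apply: measurable_fun_pair => //.
    exact: (measurableT_comp measurable_fst measurable_fst).
  apply: (measurableT_comp mf); apply: measurable_fun_pair.
    exact: (measurableT_comp measurable_fst measurable_fst).
  exact: (measurableT_comp measurable_snd measurable_fst).
have g0 p : 0 <= g p by rewrite /g; case: ifP.
have -> : slice_davg n = fun z =>
    ((r *+ 2)^-1%:E * fubini_F mu (EFin \o g) z)%E.
  apply/funext => -[x y]; rewrite /slice_davg /davg /iavg /=.
  rewrite lebesgue_measure_ball// inver mulrn_eq0/= invr_eq0 pnatr_eq0/=.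
  congr (_ * _)%E; rewrite integral_mkcond /fubini_F; apply: eq_integral => t _.
  rewrite patchE /g /=.
  case: ifPn; rewrite ?inE ?notin_setE /ball/=; first by move=> ->.
  by move=> /negP/negbTE ->.
apply: measurable_funeM.
apply: measurable_fun_fubini_tonelli_F; first exact/measurable_EFinP.
by move=> z; rewrite lee_fin.
Qed.

(** Lebesgue differentiation gives, for each [x], almost every [y]. The exceptional sets are
    measurable in the plane, so Fubini exchanges the two quantifiers. *)
Lemma ae_lebesgue_slices : {ae mu, forall y : T, {ae mu, forall x : T, forall k,
  \forall n \near \oo, (slice_davg n (x, y) < k.+1%:R^-1%:E)%E}}.
Proof.
(* The points where the mean deviation is at least 1/(k+1) for infinitely many [n]. *)
pose B k : set (T * T) := \bigcap_(N in [set: nat])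
  \bigcup_(n in [set n | (N <= n)%N])
  [set z | (k.+1%:R^-1%:E <= slice_davg n z)%E].
have mB k : measurable (B k).
  apply: bigcap_measurable => // N _; apply: bigcup_measurable => n _.
  rewrite -[X in measurable X]setTI.
  by apply: emeasurable_fun_c_infty => //; exact: measurable_slice_davg.
have B0 k : {ae mu, forall y, mu (ysection (B k) y) = 0%E}.
  apply/(null_ysection mu mu (mB k))/(null_xsection mu mu (mB k)).
  apply: aeW => x /=.
  apply/negligibleP; first exact: measurable_xsection.
  have := lebesgue_differentiation (lf x); apply: negligibleS => y /=.
  rewrite /xsection/= inE => Bxy xy.
  have /fine_cvgP[fin /cvgr0_norm_lt fine0] :
      slice_davg n (x, y) @[n --> \oo] --> 0%E.
    apply: ((cvge_at_rightP _ 0 0).1 xy harmonic).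
    by split=> [n|]; [exact: harmonic_gt0|exact: cvg_harmonic].
  have k0 : 0 < k.+1%:R^-1 :> R by [].
  have [N _ NP] := filterI fin (fine0 _ k0).
  have [n /= Nn] := Bxy N Logic.I.
  rewrite leNgt => /negP; apply.
  have [fn] := NP n Nn; rewrite ltr_norml => /andP[_].
  by rewrite -lte_fin fineK.
have {}B0 := ae_foralln B0.
apply: filterS B0 => y By; apply: ae_foralln => k.
exists (ysection (B k) y); split; [exact: measurable_ysection|exact: By|].
move=> x /= nk; rewrite /ysection/= inE => N _; apply: contrapT => nB; apply: nk.
exists N => //= n /= Nn; rewrite ltNge; apply/negP => le; apply: nB.
by exists n.
Qed.

End lebesgue_points.

Section graphon_points.
Context {R : realType}.
Local Notation T := (measurableTypeR R).
Local Notation mu := (@lebesgue_measure R).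

(** At a Lebesgue point of a slice, Markov's inequality bounds the measure of the points of a small
    ball with deviation at least [e], so these have density 0. Extending [W] by 0 makes its slices
    locally integrable on the line. *)
Lemma ae_density_cvg (W : T * T -> R) : is_graphon W ->
  {ae mu, forall y0 : T, {ae mu, forall x : T, forall e : R, 0 < e ->
    density_filter y0 [set y |
      `|(W \_ (I01 `*` I01)) (x, y) - (W \_ (I01 `*` I01)) (x, y0)| < e]}}.
Proof.
move=> [mW _ W01]; set f := W \_ _.
have mI : measurable (@I01 R) by exact: measurable_itv.
have mf : measurable_fun setT f.
  by apply/(measurable_restrictT _ _).1 => //; exact: measurableX.
have mfx x : measurable_fun setT (fun y => f (x, y)).
  exact: (measurableT_comp mf (pair1_measurable x)).
have lf x : locally_integrable setT (fun y => f (x, y)).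
  apply: open_integrable_locally; first exact: openT.
  apply: (le_integrable measurableT _ _ (integrable_indic_itv 0 1 true false)).
    exact/measurable_EFinP.
  move=> y _; rewrite /= lee_fin /f patchE/= indicE.
  case: ifPn => [|_]; last by rewrite normr0.
  rewrite inE => -[/= Ix Iy]; have /andP[W0 W1] := W01 x y Ix Iy.
  by rewrite mem_set// normr1 ger0_norm.
have := ae_lebesgue_slices mf lf.
apply: filterS => y0; apply: filterS => x sl e e0.
pose B := [set y | e <= `|f (x, y) - f (x, y0)|].
have mB : measurable B.
  rewrite -[B]setTI; apply: measurable_fun_le => //.
  by apply: measurableT_comp => //; exact: measurable_funB.
exists B; split => //.
  by move=> y /= /negP; rewrite -leNgt.
move=> d d0.
(* On a ball of length 2r, a mean below d e / 2 gives an integral below d e r; dividing by [e]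
   leaves d r. *)
have de0 : 0 < d * e / 2 by rewrite divr_gt0// mulr_gt0.
have [k _ /(_ k (leqnn k)) /= kde] := near_infty_natSinv_lt (PosNum de0).
have := sl k; apply: filterS => n; rewrite /slice_davg /davg /iavg/=.
set r : R := n.+1%:R^-1; have r0 : 0 < r by rewrite invr_gt0.
rewrite lebesgue_measure_ball ?(ltW r0)// inver mulrn_eq0/= (gt_eqF r0).
set J := (\int[mu]_(_ in _) _)%E => HJ.
have : (e%:E * mu (ball y0 r `&` B) <= J)%E.
  have := @le_integral_abse _ _ _ mu (ball y0 r) (measurable_ball y0 r)
    (fun y => (f (x, y) - f (x, y0))%:E) e _ e0.
  apply; apply/measurable_EFinP; apply: measurable_funB => //.
  exact: measurable_funTS.
rewrite setIC => le1.
rewrite -(@lee_pmul2l _ e%:E)//.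
apply: (le_trans le1); move: HJ => /ltW.
rewrite -(@lee_pmul2l _ (r *+ 2)%:E)// ?lte_fin ?mulrn_wgt0//.
rewrite muleA -EFinM divff ?mul1e; last by rewrite mulrn_eq0/= gt_eqF.
move=> /le_trans; apply; rewrite -!EFinM lee_fin.
have aux (a b c q : R) : 0 < a -> q < b * c / 2 -> a *+ 2 * q <= c * (b * a).
  by rewrite (mulr2n a) => a0; rewrite -(ltr_pM2l a0) => ?; lra.
exact: aux.
Qed.

End graphon_points.

(** * From a graphon to weights *)

Section ae_ultrafilters.
Context {R : realType}.
Local Notation T := (measurableTypeR R).
Local Notation mu := (@lebesgue_measure R).

Lemma ae_lebesgue_filter : Filter (almost_everywhere mu).
Proof. exact: ae_filter_ringOfSetsType. Qed.

Lemma ae_ultra_refine (G : set_system T) : ProperFilter G ->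
  almost_everywhere mu `<=` G -> G I01 -> exists2 U, ae_ultra U & G `<=` U.
Proof.
move=> PG aeG GI; have [U [UU GU]] := ultraFilterLemma PG.
by exists U => //; split => //; [exact: subset_trans GU|exact: GU].
Qed.

(** The conull filter restricted to [D] within [0,1] is proper exactly because this set is not null;
    any ultrafilter refining it works. *)
Lemma ae_ultra_mem (D : set T) :
  ~ {ae mu, forall x, I01 x -> ~ D x} -> exists2 U, ae_ultra U & U D.
Proof.
move=> nD; pose G := within (I01 `&` D) (almost_everywhere mu).
have PG : ProperFilter G.
  split; last by exact: (within_filter _ ae_lebesgue_filter).
  move=> G0; apply: nD; move: G0; rewrite /G /within.
  by apply: (@filterS T _ ae_lebesgue_filter) => x /= xD Ix Dx; apply: xD.
have [||U aeU GU] := @ae_ultra_refine G PG.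
- by move=> A; apply: (@filterS T _ ae_lebesgue_filter) => x Ax _.
- by apply: aeW => x [].
- by exists U => //; apply: GU; apply: aeW => x [].
Qed.

Lemma positive_nonnegligible (D : set T) : measurable D -> D `<=` I01 ->
  (0 < mu D)%E -> ~ {ae mu, forall x, I01 x -> ~ D x}.
Proof.
move=> mD DI D0 ae; have /(negligibleP _ mD) : mu.-negligible D.
  by apply: negligibleS ae => x Dx /= /(_ (DI _ Dx)); exact.
by move=> D00; move: D0; rewrite D00 ltxx.
Qed.

(** In this form it feeds [ae_ultra_mem] and shows that an [ae_ultra] exists. *)
Lemma I01_nonnegligible : ~ {ae mu, forall x, I01 x -> ~ [set: T] x}.
Proof.
have := @positive_nonnegligible I01 (measurable_itv _) (fun x Ix => Ix).
rewrite /I01 lebesgue_measure_itv/= lte01 oppr0 adde0 => /(_ lte01) nae ae.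
by apply: nae; apply: (@filterS T _ ae_lebesgue_filter) ae => x xI /xI.
Qed.

(** If |f - c| >= 1/(n+1) held on a non-null part of [0,1], an ultrafilter through that part would
    contradict the limit. *)
Lemma ultra_ae_eq (f : T -> R) (c : R) :
  (forall U, ae_ultra U -> forall e : R, 0 < e -> U [set x | `|f x - c| < e]) ->
  {ae mu, forall x, I01 x -> f x = c}.
Proof.
move=> fc.
have /ae_foralln : forall n, {ae mu, forall x, I01 x -> `|f x - c| < n.+1%:R^-1}.
  move=> n; apply: contrapT => nae.
  have [|U aeU UD] := @ae_ultra_mem [set x | ~ `|f x - c| < n.+1%:R^-1].
    move=> ae; apply: nae; apply: (@filterS T _ ae_lebesgue_filter) ae => x /= xI Ix.
    exact: contrapT (xI Ix).
  have n0 : 0 < n.+1%:R^-1 :> R by [].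
  have [UU _ _] := aeU.
  by have [x []] := filter_ex (filterI UD (fc U aeU _ n0)).
apply: (@filterS T _ ae_lebesgue_filter) => x xn Ix.
apply/eqP; rewrite -subr_eq0 -normr_le0.
apply/ler_addgt0Pr => e e0; rewrite add0r.
have [N _ /(_ N (leqnn N)) /= Ne] := near_infty_natSinv_lt (PosNum e0).
exact/ltW/(lt_trans (xn N Ix)).
Qed.

End ae_ultrafilters.

Section graphon_to_weights.
Context {R : realType} {m : nat}.
Local Notation T := (measurableTypeR R).
Local Notation mu := (@lebesgue_measure R).
Hypothesis m_gt0 : (0 < m)%N.
Variables (Phi : {ptws edge m -> R} -> R) (W : T * T -> R) (h : T -> R).
Hypotheses (Phi_cont : {within cube, continuous Phi}) (gW : is_graphon W).
Hypothesis Phi_sum : {ae @lebesgue_tuple R m, forall x : m.-tuple T,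
  (forall i, I01 (tnth x i)) -> Phi_graphon Phi W x = \sum_(i < m) h (tnth x i)}.

(** [Phi] is bounded, so freezing all coordinates but the first bounds [h] up to a constant. This is
    what makes the ultrafilter limits of [h] exist. *)
Lemma ae_bounded_summand : exists M : R, {ae mu, forall x, I01 x -> `|h x| <= M}.
Proof.
have [M MP] := cube_bounded Phi_cont; have [_ _ W01] := gW.
have : {ae @lebesgue_tuple R m, forall x : m.-tuple T,
  (forall i, I01 (tnth x i)) -> `|\sum_(i < m) h (tnth x i)| <= M}.
  apply: filterS Phi_sum => x xsum xI; rewrite -xsum//; apply: MP => e.
  exact: W01.
case: m m_gt0 => // n _ sumM {MP}.
have : {ae @lebesgue_tuple R n, forall t, {ae mu, forall x,
  (forall i, I01 (tnth (tuple_cons (x, t)) i)) ->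
    `|\sum_(i < n.+1) h (tnth (tuple_cons (x, t)) i)| <= M}}.
  apply: (@ae_ysection _ _ T _ R mu (@lebesgue_tuple R n) (fun z =>
    (forall i, I01 (tnth (tuple_cons z) i)) ->
    `|\sum_(i < n.+1) h (tnth (tuple_cons z) i)| <= M)).
  move: sumM => [A [mA A0 PA]].
  exists (@tuple_cons R n @^-1` A); split => //.
    by rewrite -[X in measurable X]setTI; exact: measurable_tuple_cons.
  by move=> z /= nP; apply: PA.
(* Any such ultrafilter serves here, only to extract one good tuple of frozen coordinates in
   [0,1]. *)
have [U [UU aeU UI] _] := @ae_ultra_mem R setT I01_nonnegligible.
have PU : ProperFilter U by exact: ultra_proper.
have FU : Filter U by exact: filter_filter.
move=> /(ae_iter_near (F := fun=> U) (fun=> FU) (fun=> aeU)).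
move=> /(iter_nearI (fun=> FU) (@iter_near_tnth _ n (fun=> U) (fun=> I01)
  (fun=> FU) (fun i _ => UI))).
move=> /(iter_near_ex (fun=> PU))[t [tI tM]].
exists (M + `|\sum_(i < n) h (tnth t i)|).
move: tM; apply: (@filterS T _ ae_lebesgue_filter) => x xM Ix.
have : `|h x + \sum_(i < n) h (tnth t i)| <= M.
  have := xM _; rewrite big_ord_recl.
  under eq_bigr do rewrite tnthS.
  apply => i; case: (unliftP ord0 i) => [j ->|-> //]; rewrite tnthS; exact: tI.
have := ler_normB (h x + \sum_(i < n) h (tnth t i)) (\sum_(i < n) h (tnth t i)).
by rewrite addrK; lra.
Qed.

Lemma subset_weights_const (u : R) (A B : {set 'I_m}) :
  subset_weights u u u A = subset_weights u u u B.
Proof.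
apply/funext => e; rewrite /subset_weights; case: (val e) => i j.
by rewrite !if_same.
Qed.

Lemma graphon_to_weights : ~ ae_zero h -> ~ ae_constant_graphon W ->
  exists u v s a b : R,
    [/\ [/\ 0 <= u <= 1, 0 <= v <= 1 & 0 <= s <= 1],
        ~ (u = v /\ v = s),
        ~ (a = 0 /\ b = 0) &
        forall A : {set 'I_m},
          Phi (subset_weights u v s A) = a + b * #|A|%:R].
Proof.
move=> h_neq0 W_ncst; apply: contrapT => nex; apply: W_ncst.
have [mW symW W01] := gW.
have m0 : m%:R != 0 :> R by rewrite pnatr_eq0 -lt0n.
pose hlim U a := forall e : R, 0 < e -> U [set x | `|h x - a| < e].
have hlim_ex U : ae_ultra U -> exists a, hlim U a.
  move=> [UU aeU UI]; have [M hM] := ae_bounded_summand.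
  have UM : U [set x | - M <= h x <= M].
    by apply: filterS2 UI (aeU _ hM) => x Ix /= /(_ Ix); rewrite ler_norml.
  by have [a _ ha] := ultra_lim UU UM; exists a.
have Wlim U V : ae_ultra U -> ae_ultra V ->
    exists2 c : R, 0 <= c <= 1 & near2 U V W c.
  move=> [UU aeU UI] [UV aeV VI]; apply: ultra_lim2.
  by apply: filterS UI => x Ix; apply: filterS VI => y Iy; exact: W01.
(* Otherwise the configuration of [U] and [V] would supply the excluded weights, with intercept m b
   and slope a - b. *)
have key U V (u v s a b : R) : ae_ultra U -> ae_ultra V ->
    0 <= u <= 1 -> 0 <= v <= 1 -> 0 <= s <= 1 ->
    near2 U U W u -> near2 V V W v -> near2 U V W s -> hlim U a -> hlim V b ->
    (u = v /\ v = s) \/ (a = 0 /\ b = 0).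
  move=> aeU aeV u01 v01 s01 Uu Vv UVs Ua Vb; apply: contrapT => /not_orP[nuvs nab].
  apply: nex; exists u, v, s, (m%:R * b), (a - b); split => //.
    move=> [/eqP]; rewrite mulf_eq0 (negPf m0)/= => /eqP b0.
    by rewrite b0 subr0 => a0; apply: nab.
  by move=> A; exact: (ultra_configuration Phi_cont gW Phi_sum A aeU aeV).
(* When u = v = s, the weights do not depend on the subset; comparing the empty set with the full
   one gives m (a - b) = 0. *)
have hlim_eq U V a b : ae_ultra U -> ae_ultra V -> hlim U a -> hlim V b -> a = b.
  move=> aeU aeV Ua Vb.
  have [u u01 Uu] := Wlim U U aeU aeU; have [v v01 Vv] := Wlim V V aeV aeV.
  have [s s01 UVs] := Wlim U V aeU aeV.
  have [[uv vs]|[-> ->]//] :=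
    key U V u v s a b aeU aeV u01 v01 s01 Uu Vv UVs Ua Vb.
  subst v s.
  have E A := ultra_configuration Phi_cont gW Phi_sum A aeU aeV u01 v01 s01
    Uu Vv UVs Ua Vb.
  have := E finset.set0.
  rewrite (subset_weights_const u finset.set0 (finset.setTfor 'I_m)) E.
  rewrite cards0 mulr0 cardsT card_ord => /addrI/eqP.
  by rewrite mulf_eq0 (negPf m0) orbF subr_eq0 => /eqP.
have [U0 [a0 [aeU0 Ua0 a0_neq0]]] : exists U a, [/\ ae_ultra U, hlim U a & a <> 0].
  apply: contrapT => nUa; apply: h_neq0; apply: ultra_ae_eq => U aeU e e0.
  have [a Ua] := hlim_ex U aeU; have [a0|an0] := pselect (a = 0).
    by rewrite -a0; exact: Ua.
  by case: nUa; exists U, a.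
(* All limits of [h] equal [a0], which is nonzero, so only the first alternative of [key]
   remains. *)
have Wlim_eq U V (u v s : R) : ae_ultra U -> ae_ultra V ->
    0 <= u <= 1 -> 0 <= v <= 1 -> 0 <= s <= 1 ->
    near2 U U W u -> near2 V V W v -> near2 U V W s -> u = v /\ v = s.
  move=> aeU aeV u01 v01 s01 Uu Vv UVs.
  have [a Ua] := hlim_ex U aeU; have [b Vb] := hlim_ex V aeV.
  have [//|[a00 _]] := key U V u v s a b aeU aeV u01 v01 s01 Uu Vv UVs Ua Vb.
  by case: a0_neq0; rewrite (hlim_eq U0 U a0 a).
have [c c01 U0c] := Wlim U0 U0 aeU0 aeU0.
(* The pair of [U0] and [U] identifies [c] with the double limit along [U], and the pair of [U] and
   [V] carries it to the mixed limit. *)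
have near2_c U V : ae_ultra U -> ae_ultra V -> near2 U V W c.
  move=> aeU aeV.
  have [u u01 Uu] := Wlim U U aeU aeU; have [v v01 Vv] := Wlim V V aeV aeV.
  have [s s01 UVs] := Wlim U V aeU aeV.
  have [s' s'01 U0Us'] := Wlim U0 U aeU0 aeU.
  have [cu _] := Wlim_eq U0 U c u s' aeU0 aeU c01 u01 s'01 U0c Uu U0Us'.
  have [uv vs] := Wlim_eq U V u v s aeU aeV u01 v01 s01 Uu Vv UVs.
  by rewrite cu uv vs.
exists c.
pose B := (I01 `*` I01) `&` W @^-1` (~` [set c]).
have mI : measurable (@I01 R) by exact: measurable_itv.
have mB : measurable B.
  apply: mW; first exact: measurableX.
  by apply: measurableC.
suff B0 : {ae mu, forall y, mu (ysection B y) = 0%E}.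
  exists B; split => //; first exact/(null_ysection mu mu mB).
  by move=> z /= /not_implyP[].
(* The endpoints 0 and 1 are discarded because [0,1] has density 1 only at its interior points. *)
have ae_neq a : {ae mu, forall y : T, y <> a}.
  exists [set a]; split => //; first exact: lebesgue_measure_set1.
  by move=> y /= /contrapT.
apply: (@filterS3 T _ ae_lebesgue_filter) (ae_density_cvg gW) (ae_neq 0) (ae_neq 1).
move=> y0 y0cvg y0_neq0 y0_neq1.
apply/(negligibleP _ (measurable_ysection y0 mB)).
have [Iy0|nIy0] := pselect (I01 y0); last first.
  rewrite (_ : ysection B y0 = set0); first exact: negligible_set0.
  apply/seteqP; split=> // x; rewrite /ysection/= inE => -[[_ Iy]] _.
  exact: nIy0.
have y01 : 0 < y0 < 1.
  move: Iy0; rewrite /I01/= in_itv/= => /andP[y00 y01].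
  rewrite !lt_neqAle y00 y01 !andbT; apply/andP; split; apply/eqP => //.
  exact/nesym.
have [V aeV dV] := ae_ultra_refine (density_filter_proper y0)
  (@ae_density_filter _ y0) (density_filter_I01 y01).
suff : {ae mu, forall x, I01 x -> W (x, y0) = c}.
  apply: negligibleS => x; rewrite /ysection/= inE => -[[/= Ix _]] xc Hx.
  exact/xc/Hx.
(* For [U]-most [x], some [y] in [0,1] has W(x, y) within e / 2 both of [c], by the double limit,
   and of W(x, y0), because [V] refines the density filter at [y0]. *)
apply: ultra_ae_eq => U aeU e e0.
have e2 : 0 < e / 2 by rewrite divr_gt0.
have [UU sU UI] := aeU; have [UV sV VI] := aeV.
apply: filterS3 UI (sU _ y0cvg) (near2_c U V aeU aeV _ e2) => x Ix.
move=> /(_ _ e2)/dV Vx Vc.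
have [y [[Iy /= y1] y2]] := filter_ex (filterI (filterI VI Vx) Vc).
move: y1; rewrite !patchE !mem_set//= => y1.
have := ler_distD (W (x, y)) (W (x, y0)) c; rewrite (distrC (W (x, y0)) (W (x, y))).
by move: y2 => /=; lra.
Qed.

End graphon_to_weights.

(** * Two-type graphons *)

Section two_types.
Context {R : realType} {m : nat}.
Local Notation T := (measurableTypeR R).
Local Notation mu := (@lebesgue_measure R).
Hypothesis m_gt0 : (0 < m)%N.
Variable Phi : {ptws edge m -> R} -> R.

(** Evaluate the identity at tuples taking one value [x] from the first part on [A] and one value
    [y] from the second part elsewhere. *)
Lemma two_type_to_weights (W : T * T -> R) (h : T -> R) :
  is_two_type_graphon W -> ~ ae_zero h ->
  (forall x : m.-tuple T, (forall i, I01 (tnth x i)) ->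
    Phi_graphon Phi W x = \sum_(i < m) h (tnth x i)) ->
  ~ constant_graphon W ->
  exists u v s a b : R,
    [/\ [/\ 0 <= u <= 1, 0 <= v <= 1 & 0 <= s <= 1],
        ~ (u = v /\ v = s),
        ~ (a = 0 /\ b = 0) &
        forall A : {set 'I_m},
          Phi (subset_weights u v s A) = a + b * #|A|%:R].
Proof.
move=> [[mW symW W01] [S [mS SU SI Sc]]] h_neq0 Phi_sum W_ncst.
have S01 i x : S i x -> I01 x.
  rewrite -SU => Six; case: (unliftP ord0 i) => [j ij|i0]; last by left; rewrite -i0.
  by right; rewrite (_ : ord_max = i)// ij; apply: val_inj; rewrite /= ord1.
have ScE i j x y x' y' : S i x -> S j y -> S i x' -> S j y' -> W (x, y) = W (x', y').
  by move=> *; have [c cP] := Sc i j; rewrite !cP.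
(* If one part were empty, the other would be all of [0,1] and [W] would be constant. *)
have S0 i : S i !=set0.
  apply: contrapT => nS; apply: W_ncst.
  have [j Sj] : exists j, I01 `<=` S j.
    have nSi x : ~ S i x by move=> Six; apply: nS; exists x.
    case: (unliftP ord0 i) => [k ik|i0].
      exists ord0 => x; rewrite -SU => -[//|Sx]; case: (nSi x).
      by rewrite (_ : i = ord_max)// ik; apply: val_inj; rewrite /= ord1.
    by exists ord_max => x; rewrite -SU => -[Sx|//]; case: (nSi x); rewrite i0.
  by have [c cP] := Sc j j; exists c => x y Ix Iy; apply: cP; exact: Sj.
have [z Iz hz] : exists2 z, I01 z & h z <> 0.
  apply: contrapT => nz; apply: h_neq0; apply: aeW => x Ix.
  by apply: contrapT => hx; apply: nz; exists x.
(* A point where [h] is nonzero represents its own part; the other representative is arbitrary. *)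
have [x [y [Sx Sy hxy]]] : exists x y,
    [/\ S ord0 x, S ord_max y & ~ (h x = 0 /\ h y = 0)].
  have [x0 Sx0] := S0 ord0; have [y0 Sy0] := S0 ord_max.
  move: Iz; rewrite -SU => -[Sz|Sz].
    by exists z, y0; split => // -[].
  by exists x0, z; split => // -[].
have Ix := S01 _ _ Sx; have Iy := S01 _ _ Sy.
exists (W (x, x)), (W (y, y)), (W (x, y)), (m%:R * h y), (h x - h y); split.
- by split; exact: W01.
- move=> [uv vs]; apply: W_ncst; exists (W (x, x)) => p q.
  rewrite -SU => -[Sp|Sp] [Sq|Sq].
  + exact: (ScE _ _ _ _ _ _ Sp Sq Sx Sx).
  + by rewrite uv vs; exact: (ScE _ _ _ _ _ _ Sp Sq Sx Sy).
  + by rewrite uv vs (symW x y)//; exact: (ScE _ _ _ _ _ _ Sp Sq Sy Sx).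
  + by rewrite uv; exact: (ScE _ _ _ _ _ _ Sp Sq Sy Sy).
- move=> [/eqP]; rewrite mulf_eq0 pnatr_eq0 -[_ == 0%N]negbK -lt0n m_gt0/=.
  by move=> /eqP hy0; rewrite hy0 subr0 => hx0; apply: hxy.
move=> A; pose t : m.-tuple T := [tuple if i \in A then x else y | i < m].
have tE i : tnth t i = if i \in A then x else y by rewrite tnth_mktuple.
transitivity (Phi_graphon Phi W t).
  congr Phi; apply/funext => e; rewrite /subset_weights !tE.
  case: (val e) => i j /=.
  by case: (i \in A); case: (j \in A) => //=; exact: symW.
rewrite Phi_sum; last by move=> i; rewrite tE; case: ifP.
transitivity (\sum_(i < m) (h y + (if i \in A then h x - h y else 0))).
  apply: eq_bigr => i _; rewrite tE; case: ifP => _; last by rewrite addr0.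
  by rewrite addrC subrK.
rewrite big_split/= sumr_const card_ord -big_mkcond/= sumr_const.
by rewrite mulr_natl mulr_natr.
Qed.

(** Cut [0,1] at 1/2. The identity for all tuples together with non-constancy even a.e. lets one
    construction serve both graphon conditions. *)
Lemma weights_to_two_type (u v s a b : R) :
  0 <= u <= 1 -> 0 <= v <= 1 -> 0 <= s <= 1 ->
  ~ (u = v /\ v = s) -> ~ (a = 0 /\ b = 0) ->
  (forall A : {set 'I_m}, Phi (subset_weights u v s A) = a + b * #|A|%:R) ->
  exists (W : T * T -> R) (h : T -> R),
    [/\ is_two_type_graphon W, ~ ae_zero h,
        forall x : m.-tuple T,
          Phi_graphon Phi W x = \sum_(i < m) h (tnth x i) &
        ~ ae_constant_graphon W].
Proof.
move=> u01 v01 s01 nuvs nab PhiA.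
have m0 : m%:R != 0 :> R by rewrite pnatr_eq0 -lt0n.
pose p (x : T) := (x : R) <= 2^-1.
pose w (c d : bool) := if c then if d then u else s else if d then s else v.
pose W (z : T * T) := w (p z.1) (p z.2).
(* The intercept [a] is shared equally among the [m] coordinates, and each coordinate in the first
   half adds [b]. *)
pose h x := if p x then a / m%:R + b else a / m%:R.
pose P c : set T := if c then `[0, 2^-1]%classic else `]2^-1, 1]%classic.
have P01 c : P c `<=` I01.
  case: c => x; rewrite /P/= /I01 /= !in_itv/= => /andP[x1 x2];
    apply/andP; split => //.
  - by rewrite (le_trans x2)// invf_le1// ler1n.
  - by rewrite (le_trans _ (ltW x1)).
have pP c x : P c x -> p x = c.
  case: c; rewrite /P/= in_itv/= /p => /andP[x1 x2] //.
  by apply/negbTE; rewrite -ltNge.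
have P_pos c : ~ {ae mu, forall x, I01 x -> ~ P c x}.
  apply: positive_nonnegligible => //.
    by rewrite /P; case: c; exact: measurable_itv.
  have h0 : 0 < 2^-1 :> R by rewrite invr_gt0.
  have h1 : 2^-1 < 1 :> R by rewrite invf_lt1// ltr1n.
  case: c; rewrite /P lebesgue_measure_itv/= lte_fin.
    by rewrite h0 -EFinB lte_fin subr0.
  by rewrite h1 -EFinB lte_fin subr_gt0.
exists W, h; split.
- split.
    split; last 2 first.
    + by move=> x y _ _; rewrite /W /w; do 2 case: ifP.
    + by move=> x y _ _; rewrite /W /w; do 2 case: ifP.
    apply: measurable_funTS.
    apply: measurable_fun_ifT; first exact: measurable_fun_ler.
      by apply: measurable_fun_ifT => //; exact: measurable_fun_ler.
    by apply: measurable_fun_ifT => //; exact: measurable_fun_ler.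
  exists (fun i => P (i == ord0)); split.
  + by move=> i; rewrite /P; case: ifP => _; exact: measurable_itv.
  + apply/seteqP; split=> x; first by case=> Px; exact: (P01 _ _ Px).
    rewrite /I01 /P/= !in_itv/= => /andP[-> ->]; rewrite andbT.
    by have [|] := leP x 2^-1; [left|right].
  + by apply/seteqP; split=> // x [/pP px /pP]; rewrite px.
  + by move=> i j; exists (w (i == ord0) (j == ord0)) => x y /pP <- /pP <-.
- move=> h0.
  have h_eq0 c x : P c x -> h x = 0.
    move=> Pcx; apply: contrapT => hx; apply: (P_pos c).
    apply: (@filterS T _ ae_lebesgue_filter) h0 => y hy Iy Pcy; apply: hx.
    by rewrite -(hy Iy) /h (pP c x)// (pP c y).
  apply: nab.
  have h0' : 0 <= 2^-1 :> R by rewrite invr_ge0.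
  have h1' : 2^-1 < 1 :> R by rewrite invf_lt1// ltr1n.
  have P0 : P true 0 by rewrite /P/= in_itv/= lexx.
  have P1 : P false 1 by rewrite /P/= in_itv/= lexx andbT.
  have := h_eq0 _ _ P1; rewrite /h (pP _ _ P1) => /eqP.
  rewrite mulf_eq0 invr_eq0 (negPf m0) orbF => /eqP a0.
  have := h_eq0 _ _ P0; rewrite /h (pP _ _ P0) a0 mul0r add0r.
  by [].
- move=> x; pose A := [set i | p (tnth x i)]%SET.
  have -> : Phi_graphon Phi W x = Phi (subset_weights u v s A).
    congr Phi; apply/funext => e; rewrite /subset_weights.
    case: (val e) => i j /=; rewrite !inE /W /w/=.
    by case: (p _); case: (p _).
  rewrite PhiA.
  transitivity (\sum_(i < m) (a / m%:R + (if i \in A then b else 0))); last first.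
    by apply: eq_bigr => i _; rewrite inE /h; case: ifP; rewrite ?addr0.
  rewrite big_split/= sumr_const card_ord -big_mkcond/= sumr_const.
  by rewrite -(mulr_natr (a / _) m) divfK// mulr_natr.
- move=> [c ae_c].
  (* Both halves have positive measure, so by Fubini the a.e. value [c] is attained on every pair of
     types. *)
  have wc d e : w d e = c.
    apply: contrapT => wne; apply: (P_pos d).
    have := ae_xsection ae_c.
    apply: (@filterS T _ ae_lebesgue_filter) => x aey Ix Pdx.
    apply: (P_pos e); apply: (@filterS T _ ae_lebesgue_filter) aey => y Wc Iy Pey.
    by apply: wne; rewrite -Wc//= /W/= (pP d x)// (pP e y).
  by apply: nuvs; split; [rewrite -[u]/(w true true) wc -(wc false false)
    | rewrite -[v]/(w false false) wc -(wc true false)].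
Qed.

End two_types.

(** * Equivalence of the three conditions *)

Theorem theorem5p3 (R : realType) (m : nat) (m_ge2 : (2 <= m)%N)
    (Phi : {ptws edge m -> R} -> R)
    (Phi_cont : {within cube, continuous Phi}) :
  [<->
    exists (W : measurableTypeR R * measurableTypeR R -> R)
           (h : measurableTypeR R -> R),
      [/\ is_graphon W,
          ~ ae_zero h,
          {ae @lebesgue_tuple R m, forall x : m.-tuple (measurableTypeR R),
            (forall i, I01 (tnth x i)) ->
            Phi_graphon Phi W x = \sum_(i < m) h (tnth x i)} &
          ~ ae_constant_graphon W];
    exists (W : measurableTypeR R * measurableTypeR R -> R)
           (h : measurableTypeR R -> R),
      [/\ is_two_type_graphon W,
          ~ ae_zero h,
          (forall x : m.-tuple (measurableTypeR R),
            (forall i, I01 (tnth x i)) ->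
            Phi_graphon Phi W x = \sum_(i < m) h (tnth x i)) &
          ~ constant_graphon W];
    exists u v s a b : R,
      [/\ [/\ 0 <= u <= 1, 0 <= v <= 1 & 0 <= s <= 1],
          ~ (u = v /\ v = s),
          ~ (a = 0 /\ b = 0) &
          forall A : {set 'I_m},
            Phi (subset_weights u v s A) = a + b * #|A|%:R] ].
Proof.
have m_gt0 : (0 < m)%N := ltnW m_ge2.
have from_weights (u v s a b : R) := @weights_to_two_type R m m_gt0 Phi u v s a b.
tfae.
(* The step from (i) to (ii) passes through the weights of (iii), from which a new graphon is
   built. *)
- move=> [W [h [gW h_neq0 Phi_sum W_ncst]]].
  have [u [v [s [a [b [[u01 v01 s01] nuvs nab PhiA]]]]]] :=
    graphon_to_weights m_gt0 Phi_cont gW Phi_sum h_neq0 W_ncst.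
  have [W' [h' [gW' h'_neq0 Phi_sum' W'_ncst]]] :=
    from_weights u v s a b u01 v01 s01 nuvs nab PhiA.
  exists W', h'; split => // -[c cP]; apply: W'_ncst; exists c.
  by apply: aeW => -[x y] [/= Ix Iy]; exact: cP.
- move=> [W [h [gW h_neq0 Phi_sum W_ncst]]].
  exact: two_type_to_weights gW h_neq0 Phi_sum W_ncst.
- move=> [u [v [s [a [b [[u01 v01 s01] nuvs nab PhiA]]]]]].
  have [W [h [[gW _] h_neq0 Phi_sum W_ncst]]] :=
    from_weights u v s a b u01 v01 s01 nuvs nab PhiA.
  by exists W, h; split => //; apply: aeW => x _.
Qed.
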